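(* Let $\lambda\ge1$ be an integer and let $k\in\{0,1,\dots,\lambda-1\}$. Then the function $$G_k^{(\lambda)}(z,\bar z)=\frac{(z-\bar z)^{2\lambda-1-k}}{(\lambda-1)!}\,\frac{1}{k!}\,\partial_t^{\lambda-1}\,\frac{(1+t)^{\lambda-1}\log^k(1+t)}{\left((1+t)z-\bar z\right)^\lambda}\Bigg|_{t=0}$$ is a homogeneous polynomial in $(z,\bar z)$ of degree $\lambda-1-k$, and it is symmetric under the interchange $z\leftrightarrow\bar z$.
   Context: Here $z$ and $\bar z$ may be regarded as two independent complex variables with $z\ne\bar z$; $\log$ is the principal branch near $1$, with $\log^k$ denoting the $k$-th power. *)

(* Defs.v *)
(* MathComp, with MathComp-Analysis over the complex field R[i], R : realType. *)
From mathcomp Require Import all_boot all_order all_algebra complex.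
From mathcomp Require Import all_classical all_reals all_analysis.

Set Implicit Arguments.
Unset Strict Implicit.
Unset Printing Implicit Defensive.
Import Order.TTheory GRing.Theory Num.Theory.
Import numFieldNormedType.Exports.
Local Open Scope classical_set_scope.
Local Open Scope ring_scope.

(* The numClosedFieldType R[i]; seen through this structure, it carries the
   normed module structure over itself given by the complex modulus, so that
   derive1n below is the iterated complex derivative. *)
Definition cplx (R : realType) : numClosedFieldType := R[i]%C.

Section principal_log.
Variable R : realType.

Definition cmod (z : cplx R) : R := Num.sqrt (complex.Re z ^+ 2 + complex.Im z ^+ 2).

(* Principal argument: for z != 0 exactly one angle qualifies (for z = 0 all
   do, and xget picks an arbitrary one). *)
Definition Arg (z : cplx R) : R :=
  xget 0 [set theta | [/\ - pi < theta <= pi,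
                          complex.Re z = cmod z * cos theta
                        & complex.Im z = cmod z * sin theta]].

Definition Log (z : cplx R) : cplx R := (ln (cmod z) +i* Arg z)%C.

End principal_log.

(* w stands for the second variable \bar z, treated as independent of z. *)
Definition G (R : realType) (lambda k : nat) (z w : cplx R) : cplx R :=
  (z - w) ^+ (2 * lambda - 1 - k)%N / (lambda - 1)`!%:R
  * (1 / k`!%:R)
  * derive1n (lambda - 1)
      (fun t : cplx R =>
         (1 + t) ^+ (lambda - 1)%N * Log (1 + t) ^+ k
         / ((1 + t) * z - w) ^+ lambda) 0.

(* Main.v *)
Require Import Defs.
From mathcomp Require Import all_boot all_order all_algebra complex.
From mathcomp Require Import -(notations) mpoly.
From mathcomp Require Import all_classical all_reals all_analysis.
From mathcomp Require Import zify ring lra.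

(* Put n = lambda - 1 and d = z - w.  Since (1+t)^n Log(1+t)^k / k! is the
   x^k-coefficient of (1+t)^(n+x), Leibniz' rule at t = 0 gives
     n! d^k G_k = [x^k] sum_j C(n,j) (n+x)_(n-j) (-n-1)_j z^j d^(n-j)
   with falling factorials (a)_m.  The terms with n - j < k vanish, so d^k
   cancels and G_k is a homogeneous polynomial, nonzero at (1,1) where only
   j = n - k survives.  Expanding the powers of d and applying Vandermonde,
   the sum becomes the Jacobi form
     (-1)^n sum_i C(n,i) (n+x)_(n-i) (n-x)_i z^i w^(n-i),
   which is invariant under (x, z, w) -> (-x, w, z); as d^k picks up the same
   sign (-1)^k as x^k, G_k is symmetric. *)

Set Implicit Arguments.
Unset Strict Implicit.
Unset Printing Implicit Defensive.
Import Order.TTheory GRing.Theory Num.Theory.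
Import numFieldNormedType.Exports.
Local Open Scope classical_set_scope.
Local Open Scope ring_scope.

(** * Binomial identities *)

(** Pascal's rule on a doubly indexed family: the common induction step of Vandermonde's identity
    and of Leibniz' rule. *)
Lemma sum_pascal (V : nmodType) (a : nat -> nat -> V) m :
  \sum_(j < m.+1) (a (m - j).+1 j + a (m - j)%N j.+1) *+ 'C(m, j) =
  \sum_(j < m.+2) a (m.+1 - j)%N j *+ 'C(m.+1, j).
Proof.
rewrite [RHS]big_ord_recl /= bin0 subn0.
under [X in _ = _ + X]eq_bigr => j _.
  rewrite /bump /= add1n subSS binS mulrnDr; over.
rewrite big_split /= addrA.
under eq_bigr => j _ do rewrite mulrnDl.
rewrite big_split /=; congr (_ + _).
rewrite big_ord_recl [in RHS]big_ord_recr /= bin0 subn0 bin_small // mulr0n addr0.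
congr (_ + _); apply: eq_bigr => j _.
by rewrite /bump /= add1n -subSn // subSS.
Qed.

(** Both sides equal n! / (j! (i-j)! (n-i)!). *)
Lemma bin_trinomial n i j :
  (j <= i <= n)%N -> ('C(n, j) * 'C(n - j, i - j) = 'C(n, i) * 'C(i, j))%N.
Proof.
move=> /andP[ji leni]; have ljn := leq_trans ji leni.
apply/eqP; rewrite -(eqn_pmul2r (fact_gt0 j)) -(eqn_pmul2r (fact_gt0 (i - j))).
rewrite -(eqn_pmul2r (fact_gt0 (n - i))); apply/eqP.
transitivity n`!.
  rewrite -(bin_fact ljn) -(bin_fact (leq_sub2r j leni)) subnBA // subnK //; ring.
by rewrite -(bin_fact leni) -(bin_fact ji); ring.
Qed.

(** * Falling factorials and the Jacobi form *)

Section FallingFactorial.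
Variable A : comNzRingType.
Implicit Types x y z w : A.

Definition falling x m : A := \prod_(i < m) (x - i%:R).

Lemma falling0 x : falling x 0 = 1.
Proof. exact: big_ord0. Qed.

Lemma fallingS x m : falling x m.+1 = falling x m * (x - m%:R).
Proof. exact: big_ord_recr. Qed.

Lemma falling_add x m p : falling x (m + p) = falling x m * falling (x - m%:R) p.
Proof.
rewrite /falling big_split_ord; congr (_ * _).
by apply: eq_bigr => i _ /=; rewrite natrD opprD addrA.
Qed.

Lemma falling_opp x m : falling x m = (-1) ^+ m * falling (m%:R - 1 - x) m.
Proof.
rewrite /falling -[m in (-1) ^+ m]card_ord -prodr_const -big_split /=.
rewrite (reindex_inj rev_ord_inj); apply: eq_bigr => i _ /=.
by rewrite mulN1r natrB // -addn1 natrD; ring.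
Qed.

(** In the induction step the new factor splits as x + y - m = (x - (m-j)) + (y - j), and each part
    extends one of the two falling factorials. *)
Lemma falling_vandermonde x y m :
  falling (x + y) m =
  \sum_(j < m.+1) falling x (m - j) * falling y j *+ 'C(m, j).
Proof.
elim: m => [|m IH].
  by rewrite big_ord_recl big_ord0 !falling0 mulr1 addr0.
rewrite -(sum_pascal (fun a b => falling x a * falling y b)).
rewrite fallingS IH mulr_suml; apply: eq_bigr => j _.
rewrite !fallingS mulrnAl; congr (_ *+ _).
by rewrite natrB ?leq_ord //; ring.
Qed.

Lemma jacobi_symm n x z w :
  \sum_(j < n.+1) falling (n%:R + x) (n - j) * falling (- n.+1%:R) j
     * z ^+ j * (z - w) ^+ (n - j) *+ 'C(n, j) =
  (-1) ^+ n * \sum_(i < n.+1) falling (n%:R + x) (n - i) *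
     falling (n%:R - x) i * z ^+ i * w ^+ (n - i) *+ 'C(n, i).
Proof.
(* Since C(i,j) = 0 for i < j, the range of i can be made independent of j, so that the two sums can
   be exchanged. *)
have expand (j : 'I_n.+1) : z ^+ j * (z - w) ^+ (n - j) *+ 'C(n, j) =
    \sum_(i < n.+1) z ^+ i * (- w) ^+ (n - i) *+ ('C(n, i) * 'C(i, j)).
  transitivity (\sum_(j <= i < n.+1)
      z ^+ i * (- w) ^+ (n - i) *+ ('C(n, i) * 'C(i, j))); last first.
    rewrite -(big_mkord xpredT
      (fun i => z ^+ i * (- w) ^+ (n - i) *+ ('C(n, i) * 'C(i, j)))).
    rewrite [RHS](@big_cat_nat _ _ _ j) //=; last exact: ltnW.
    rewrite [X in _ = X + _]big_nat [X in _ = X + _]big1 ?add0r //.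
    by move=> i /andP[_ ij]; rewrite (bin_small ij) muln0.
  have lejn : (j <= n)%N by rewrite -ltnS.
  rewrite -{4}[nat_of_ord j]add0n big_addn big_mkord subSn // [z - w]addrC exprDn.
  rewrite mulr_sumr -sumrMnl; apply: eq_bigr => i _.
  have lein : (i <= n - j)%N by rewrite -ltnS.
  have leijn : (j <= i + j <= n)%N by rewrite leq_addl addnC -leq_subRL.
  rewrite -(bin_trinomial leijn) addnK mulrnAr -mulrnA mulrCA -exprD mulrC addnC.
  by rewrite mulnC subnDA subnAC.
under eq_bigr => j _ do rewrite -!mulrA -mulrnAr -mulrnAr expand !mulr_sumr.
rewrite exchange_big mulr_sumr /=; apply: eq_bigr => i _.
have lein : (i <= n)%N by rewrite -ltnS.
transitivity (z ^+ i * (- w) ^+ (n - i) * falling (n%:R + x) (n - i) *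
    (\sum_(j < i.+1) falling (i%:R + x) (i - j) *
       falling (- n.+1%:R) j *+ 'C(i, j)) *+ 'C(n, i)).
  rewrite -(big_mkord xpredT (fun j => falling (n%:R + x) (n - j) * (falling (- n.+1%:R) j *
    (z ^+ i * (- w) ^+ (n - i) *+ ('C(n, i) * 'C(i, j)))))).
  rewrite (@big_cat_nat _ _ _ i.+1) //=.
  rewrite [X in _ + X]big_nat [X in _ + X]big1 ?addr0; last first.
    by move=> j /andP[ij _]; rewrite (bin_small ij) muln0 mulr0n !mulr0.
  rewrite big_mkord mulr_sumr -sumrMnl; apply: eq_bigr => j _.
  have leji : (j <= i)%N by rewrite -ltnS.
  (* (n+x)_(n-j) = (n+x)_(n-i) (i+x)_(i-j), where the first factor is free of j; the rest is a
     Vandermonde sum. *)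
  have -> : (n - j = (n - i) + (i - j))%N by rewrite addnBA // subnK.
  rewrite falling_add !mulrnAr -!mulrnA mulnC; congr (_ *+ _).
  have -> : n%:R + x - (n - i)%:R = i%:R + x by rewrite natrB //; ring.
  ring.
rewrite -falling_vandermonde mulrnAr; congr (_ *+ _).
(* Vandermonde has produced (i+x-n-1)_i, which reflects to (-1)^i (n-x)_i; this sign joins that of
   (-w)^(n-i) to give (-1)^n. *)
rewrite [falling _ i in LHS]falling_opp.
have -> : i%:R - 1 - (i%:R + x - n.+1%:R) = n%:R - x by rewrite -natr1; ring.
have -> : (-1) ^+ n = (-1) ^+ (n - i) * (-1) ^+ i :> A by rewrite -exprD subnK.
rewrite [(- w) ^+ _]exprNn; ring.
Qed.

End FallingFactorial.

(** * Leibniz' rule for U^n L^k / h^b, with L a logarithm of U *)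

Section LogDerivatives.
Variable K : numFieldType.
Variables (D : set K) (U L h : K -> K) (z : K).
Hypothesis openD : open D.
Hypothesis U0 : forall t, D t -> U t != 0.
Hypothesis h0 : forall t, D t -> h t != 0.
Hypothesis dU : forall t, D t -> is_derive t 1 U 1.
Hypothesis dL : forall t, D t -> is_derive t 1 L (U t)^-1.
Hypothesis dh : forall t, D t -> is_derive t 1 h z.

(* The x^k-coefficient of q(x) exp(x L(t)). *)
Definition log_comb k (q : {poly K}) (t : K) : K :=
  \sum_(l < k.+1) q`_l * (L t ^+ (k - l) / (k - l)`!%:R).

Lemma is_derive_divided_power p t : D t ->
  is_derive t 1 (fun s => L s ^+ p / p`!%:R)
    (if p is p'.+1 then L t ^+ p' / p'`!%:R / U t else 0).
Proof.
move=> Dt; have dLt := dL Dt.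
have -> : (fun s => L s ^+ p / p`!%:R) = L ^+ p * cst (p`!%:R)^-1.
  by apply/funext => s; rewrite /GRing.mul /= exprfctE.
apply: is_derive_eq.
rewrite /= scaler0 add0r; case: p => [|p]; first by rewrite mul0r scale0r scaler0.
rewrite factS natrM invfM /cst /GRing.scale /=.
by field; rewrite U0 // nat1r !pnatr_eq0 -lt0n fact_gt0.
Qed.

(** Differentiating exp(x L) brings down x L' = x / U, and q absorbs the factor x. *)
Lemma is_derive_log_comb k q t : D t ->
  is_derive t 1 (log_comb k q) (log_comb k ('X * q) t / U t).
Proof.
move=> Dt.
have -> : log_comb k q = \sum_(l < k.+1) (q`_l \*: (fun s => L s ^+ (k - l) / (k - l)`!%:R)).
  by apply/funext => s; rewrite fct_sumE.
have dl (l : 'I_k.+1) := is_derive_divided_power (k - l) Dt.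
apply: is_derive_eq.
(* The last summand on the left is the derivative of a constant, the first on the right has
   coefficient 0; the others match after a shift by one. *)
rewrite /log_comb big_ord_recr [in RHS]big_ord_recl /= subnn scaler0 addr0.
rewrite coefXM mul0r add0r mulr_suml; apply: eq_bigr => l _.
rewrite coefXM /bump /= add1n subnS.
by case: (k - l)%N (subn_gt0 l k) => [|p] /=; rewrite ?ltn_ord // /GRing.scale /= mulrA.
Qed.

Lemma log_combD k p q t : log_comb k (p + q) t = log_comb k p t + log_comb k q t.
Proof. by rewrite -big_split /=; apply: eq_bigr => l _; rewrite coefD mulrDl. Qed.

Lemma log_combC k c q t : log_comb k (c%:P * q) t = c * log_comb k q t.
Proof. by rewrite mulr_sumr; apply: eq_bigr => l _; rewrite coefCM mulrA. Qed.

Variables (n k b : nat).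

(** The x^k-coefficient of (n+x)_m U^(n+x-m) (-b)_j z^j h^(-b-j), with U^x = exp(x L): m derivatives
    fall on U^(n+x) and j on h^(-b). The quotient of powers of U stays correct for m > n, unlike a
    truncated exponent n - m. *)
Definition log_term m j (t : K) : K :=
  log_comb k (falling ((n%:R)%:P + 'X) m) t * (U t ^+ n / U t ^+ m) *
  (falling (- b%:R) j * z ^+ j / h t ^+ (b + j)).

(** The factor n + x - m that raises m has two sources: n - m comes from U^n / U^m, and x from exp(x
    L). *)
Lemma is_derive_log_term m j t : D t ->
  is_derive t 1 (log_term m j) (log_term m.+1 j t + log_term m j.+1 t).
Proof.
move=> Dt; have dUt := dU Dt; have dht := dh Dt.
have dV (f : K -> K) df : f t != 0 -> is_derive t 1 f df ->
    is_derive t 1 (fun s => (f s)^-1) (- f t ^- 2 *: df).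
  move=> f0 [dft <-]; apply: DeriveDef; first exact: derivableV.
  exact: deriveV.
pose F : {poly K} := falling ((n%:R)%:P + 'X) m; have dl := is_derive_log_comb k F Dt.
have Um0 : (U ^+ m) t != 0 by rewrite exprfctE expf_neq0 // U0.
have hj0 : (h ^+ (b + j)) t != 0 by rewrite exprfctE expf_neq0 // h0.
have dUm := dV _ _ Um0 (is_deriveX m dUt).
have dhj := dV _ _ hj0 (is_deriveX (b + j) dht).
have -> : log_term m j = log_comb k F * (U ^+ n * (fun s => ((U ^+ m) s)^-1)) *
    (cst (falling (- b%:R) j * z ^+ j) * (fun s => ((h ^+ (b + j)) s)^-1)).
  by apply/funext => s; rewrite /log_term /GRing.mul /= !exprfctE.
apply: is_derive_eq.
rewrite /log_term -/F !fallingS -/F.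
have -> : F * ((n%:R)%:P + 'X - m%:R) = (n%:R - m%:R)%:P * F + 'X * F.
  by rewrite polyCB -polyC_natr [m%:R%:P]polyC_natr; ring.
rewrite log_combD log_combC addnS !exprfctE /cst /GRing.scale /= mulr0 addr0.
set P := log_comb k F t; set Q := log_comb k ('X * F) t.
have Ut := U0 Dt; have ht := h0 Dt.
(* For p = 0 the truncated [p.-1] is harmless, as the factor p kills both sides. *)
have pow_pred (x : K) p : x != 0 -> p%:R * x ^+ p.-1 = p%:R * x ^+ p / x.
  by case: p => [_|p x0]; rewrite ?mulr0n ?mul0r // exprSr mulrA mulfK.
rewrite !pow_pred // natrD.
rewrite !mulrfctE -/P.
by rewrite !exprS; field; rewrite Ut ht !expf_neq0.
Qed.

Lemma derive1n_log_term c i t : D t ->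
  derive1n i (c \*: log_term 0 0) t = c * \sum_(j < i.+1) log_term (i - j) j t *+ 'C(i, j).
Proof.
elim: i t => [|i IH] t Dt; first by rewrite big_ord1 subnn.
rewrite derive1nS derive1E.
transitivity ('D_1 (c \*: \sum_(j < i.+1) ('C(i, j)%:R \*: log_term (i - j) j)) t).
  (* The induction hypothesis holds only on [D]; as [D] is open, it is an equality near t, which is
     enough to differentiate. *)
  apply: near_eq_derive; have := open_nbhs_nbhs (conj openD Dt).
  apply: filterS => s Ds; rewrite IH //= fct_sumE; congr (_ * _).
  by apply: eq_bigr => j _ /=; rewrite /GRing.scale /= mulr_natl.
have dl (j : 'I_i.+1) := is_derive_log_term (i - j) j Dt.
rewrite -(sum_pascal (fun m j => log_term m j t)) derive_val; congr (_ * _).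
by apply: eq_bigr => j _; rewrite /GRing.scale /= mulr_natl.
Qed.

Lemma derive1n_log_power i t : D t -> L t = 0 -> U t = 1 ->
  derive1n i (fun s => U s ^+ n * L s ^+ k / h s ^+ b) t =
  k`!%:R * \sum_(j < i.+1) (falling ((n%:R)%:P + 'X) (i - j))`_k *
     falling (- b%:R) j * z ^+ j / h t ^+ (b + j) *+ 'C(i, j).
Proof.
move=> Dt L0 U1.
have -> : (fun s => U s ^+ n * L s ^+ k / h s ^+ b) = k`!%:R \*: log_term 0 0.
  (* For q = 1 only l = 0 contributes, giving L^k / k!. *)
  apply/funext => s /=; rewrite /log_term /log_comb !falling0 big_ord_recl big1 => [|l _].
    rewrite coef1 subn0 /= !expr0 addn0 /GRing.scale /=; move: (h s ^- b) => y; field.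
    by rewrite pnatr_eq0 -lt0n fact_gt0.
  by rewrite coef1 mul0r.
rewrite derive1n_log_term //; congr (_ * _); apply: eq_bigr => j _; congr (_ *+ _).
(* Where L vanishes only l = k contributes, with L^0 = 1. *)
rewrite /log_term /log_comb big_ord_recr big1 /= => [|l _].
  by rewrite subnn expr0 fact0 U1 !expr1n; field; rewrite expf_neq0 ?h0.
by rewrite L0 expr0n subn_eq0 leqNgt ltn_ord mul0r mulr0.
Qed.

End LogDerivatives.

(** * The principal logarithm on the right half-plane and its complex derivative *)

Section PrincipalLog.
Variable R : realType.
Implicit Types (u v : cplx R) (x y a b q s : R).

(** The sign of the sine tells [0, pi] from ]-pi, 0[, and the cosine is injective on each. *)
Lemma cos_sin_inj a b : - pi < a <= pi -> - pi < b <= pi ->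
  cos a = cos b -> sin a = sin b -> a = b.
Proof.
move=> /andP[a1 a2] /andP[b1 b2] ec es.
have nosign (c d : R) : 0 <= c <= pi -> - pi < d < 0 -> sin c = sin d -> False.
  move=> c0 /andP[d1 d2] e; have := sin_ge0_pi c0.
  have : 0 < sin (- d) by apply: sin_gt0_pi; lra.
  rewrite sinN e; lra.
have [a0|a0] := leP 0 a; have [b0|b0] := leP 0 b.
- by apply: cos_inj => //; rewrite in_itv /=; lra.
- by exfalso; apply: (nosign a b) => //; lra.
- by exfalso; apply: (nosign b a) => //; lra.
- apply: oppr_inj; apply: cos_inj; rewrite ?cosN // in_itv /=; lra.
Qed.

Lemma normC_cmod u : `|u| = (cmod u)%:C%C.
Proof. exact: normc_def. Qed.

Lemma cmodM u v : cmod (u * v) = cmod u * cmod v.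
Proof. by case: u v => [a b] [c d]; apply: (Normc.normcM (a +i* b)%C (c +i* d)%C). Qed.

Lemma cmod_eq0 u : (cmod u == 0) = (u == 0).
Proof.
apply/eqP/eqP => [|->]; first by case: u => a b h; apply: (@Normc.eq0_normc _ (a +i* b)%C h).
by rewrite /cmod /= expr0n addr0 sqrtr0.
Qed.

Lemma Arg_unique u a : u != 0 -> - pi < a <= pi ->
  complex.Re u = cmod u * cos a -> complex.Im u = cmod u * sin a -> Arg u = a.
Proof.
move=> u0 ha hc hs.
have cu0 : cmod u != 0 by rewrite cmod_eq0.
rewrite /Arg; case: xgetP => [b -> [hb hbc hbs]|]; last first.
  by move=> /(_ a) /=; case; split.
apply: cos_sin_inj => //; apply: (mulfI cu0).
- by rewrite -hc -hbc.
- by rewrite -hs -hbs.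
Qed.

(** With q = Im u / Re u, |u| = Re u sqrt(1 + q^2) and cos(atan q) = 1 / sqrt(1 + q^2). *)
Lemma Arg_polar u : 0 < complex.Re u ->
  [/\ Arg u = atan (complex.Im u / complex.Re u),
      complex.Re u = cmod u * cos (Arg u)
    & complex.Im u = cmod u * sin (Arg u)].
Proof.
move=> u0; have p0 := pi_gt0 R.
set q := _ / _; have q1 := atan_gtNpi2 q; have q2 := atan_ltpi2 q.
have cu : cmod u = complex.Re u * Num.sqrt (1 + q ^+ 2).
  rewrite -{1}(ger0_norm (ltW u0)) -sqrtr_sqr -sqrtrM ?sqr_ge0 //; congr Num.sqrt.
  by rewrite /q; field; rewrite gt_eqF.
have s0 : Num.sqrt (1 + q ^+ 2) != 0.
  by rewrite gt_eqF // sqrtr_gt0 ltr_pwDl // sqr_ge0.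
have hc : complex.Re u = cmod u * cos (atan q).
  by rewrite cos_atan cu; field.
have hs : complex.Im u = cmod u * sin (atan q).
  have ct0 : cos (atan q) != 0 by rewrite cos_atan invr_eq0.
  have -> : sin (atan q) = q * cos (atan q) by rewrite -{2}(atanK q) /tan divfK.
  by rewrite mulrCA -hc /q divfK // gt_eqF.
suff -> : Arg u = atan q by [].
apply: Arg_unique => //; last lra.
by apply: contraTneq u0 => ->; rewrite ltxx.
Qed.

(** Both arguments lie in ]-pi/2, pi/2[, so their sum stays in ]-pi, pi[ and no multiple of 2 pi
    intervenes. *)
Lemma LogM u v : 0 < complex.Re u -> 0 < complex.Re v -> Log (u * v) = Log u + Log v.
Proof.
move=> u0 v0; have p0 := pi_gt0 R.
have [hu ruc rus] := Arg_polar u0; have [hv rvc rvs] := Arg_polar v0.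
have := atan_gtNpi2 (complex.Im u / complex.Re u).
have := atan_ltpi2 (complex.Im u / complex.Re u).
have := atan_gtNpi2 (complex.Im v / complex.Re v).
have := atan_ltpi2 (complex.Im v / complex.Re v).
rewrite -hu -hv => v1 v2 u1 u2.
have nz (w : cplx R) : 0 < complex.Re w -> w != 0.
  by apply: contraTneq => ->; rewrite ltxx.
have pos (w : cplx R) : 0 < complex.Re w -> 0 < cmod w.
  by move=> w0; rewrite lt0r cmod_eq0 nz //= sqrtr_ge0.
rewrite /Log cmodM lnM ?posrE ?pos //.
rewrite (@Arg_unique _ (Arg u + Arg v)) //.
- by rewrite mulf_neq0 ?nz.
- lra.
- have -> : complex.Re (u * v) = complex.Re u * complex.Re v - complex.Im u * complex.Im v.
    by case: (u) (v) => [a b] [c d].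
  by rewrite cmodM cosD ruc rus rvc rvs; ring.
- have -> : complex.Im (u * v) = complex.Re u * complex.Im v + complex.Im u * complex.Re v.
    by case: (u) (v) => [a b] [c d].
  by rewrite cmodM sinD ruc rus rvc rvs; ring.
Qed.

(** Follows from s/(1+s) <= ln(1+s) <= s; the lower bound is the upper one applied to 1/(1+s). *)
Lemma ln1D_approx s : `|s| <= 1 / 2 -> `|ln (1 + s) - s| <= 2 * s ^+ 2.
Proof.
rewrite !ler_norml => /andP[s1 s2].
have h1 : ln (1 + s) <= s by apply: le_ln1Dx; lra.
have h2 : s / (1 + s) <= ln (1 + s).
  have : ln (1 + (- (s / (1 + s)))) <= - (s / (1 + s)).
    by apply: le_ln1Dx; rewrite ltrNr ltr_pdivrMr; lra.
  have -> : 1 + (- (s / (1 + s))) = (1 + s)^-1 by field; lra.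
  by rewrite lnV ?posrE; lra.
have h3 : s - 2 * s ^+ 2 <= s / (1 + s) by rewrite ler_pdivlMr; nra.
nra.
Qed.

(** Mean value theorem for atan - id, whose derivative at c is -c^2/(1+c^2). *)
Lemma atan_approx q : `|atan q - q| <= `|q| ^+ 3.
Proof.
wlog q0 : q / (0 : R) <= q.
  move=> W; have [/W//|q0] := leP 0 q; have := W (- q).
  by rewrite atanN -opprD !normrN; apply; lra.
pose f : R -> R := @atan R - id.
have df x : is_derive x 1 f ((1 + x ^+ 2)^-1 - 1) by exact: is_deriveB.
have fc : {within `[0, q], continuous f}.
  by apply: derivable_within_continuous => x _; have [] := df x.
have [c] := MVT_segment q0 (fun x _ => df x) fc.
rewrite in_itv /= => /andP[c0 cq].
rewrite /f !fctE /= atan0 !subr0 => ->.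
rewrite normrM (ger0_norm q0) [q ^+ 3]exprSr ler_wpM2r //.
have -> : (1 + c ^+ 2)^-1 - 1 = - (c ^+ 2 / (1 + c ^+ 2)) by field; nra.
rewrite normrN ger0_norm; last by rewrite divr_ge0 ?addr_ge0 ?sqr_ge0.
rewrite ler_pdivrMr; nra.
Qed.

Lemma cmod_le a b : cmod (a +i* b)%C <= `|a| + `|b|.
Proof.
rewrite -(@ger0_norm _ (`|a| + `|b|)) ?addr_ge0 // -sqrtr_sqr ler_wsqrtr //=.
rewrite sqrrD !real_normK ?num_real // lerD2r lerDl.
by rewrite mulrn_wge0 // mulr_ge0.
Qed.

(** With u = x + iy and r = |u|, |1+u|^2 = 1 + s for s = 2x + r^2, so the real and imaginary parts
    reduce to the estimates of ln and atan. The radius 1/6 ensures |s| <= 3r <= 1/2. *)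
Lemma Log1D_approx u : `|u| <= (6^-1)%:C%C -> `|Log (1 + u) - u| <= 14 * `|u| ^+ 2.
Proof.
case: u => x y; set r := cmod (x +i* y)%C.
have r0 : 0 <= r by exact: sqrtr_ge0.
have r2 : r ^+ 2 = x ^+ 2 + y ^+ 2 by rewrite sqr_sqrtr // addr_ge0 ?sqr_ge0.
rewrite !normC_cmod -/r lecR => r6.
have -> : 14 * r%:C%C ^+ 2 = (14 * r ^+ 2)%:C%C :> cplx R by rewrite rmorphM rmorphXn rmorph_nat.
rewrite lecR.
have xr : `|x| <= r by rewrite -(ger0_norm r0) -ler_sqr ?nnegrE // !real_normK ?num_real // r2 lerDl sqr_ge0.
have yr : `|y| <= r by rewrite -(ger0_norm r0) -ler_sqr ?nnegrE // !real_normK ?num_real // r2 lerDr sqr_ge0.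
have /andP[x1 x2] : - r <= x <= r by rewrite -ler_norml.
have x0 : 0 < 1 + x by lra.
have u0 : 0 < complex.Re (1 + (x +i* y)%C : cplx R) by [].
have [ea _ _] := Arg_polar u0.
pose s := 2 * x + r ^+ 2.
have sr : `|s| <= 3 * r by rewrite ler_norml /s; nra.
have s1 : 0 < 1 + s by move: sr; rewrite ler_norml; lra.
have el : ln (cmod (1 + (x +i* y)%C)) = ln (1 + s) / 2.
  have -> : cmod (1 + (x +i* y)%C) = Num.sqrt (1 + s).
    by rewrite /cmod /=; congr Num.sqrt; rewrite /s r2; ring.
  by rewrite -[in RHS](sqr_sqrtr (ltW s1)) lnXn ?sqrtr_gt0 // -[ln _ *+ 2]mulr_natr mulfK.
have -> : Log (1 + (x +i* y)%C) - (x +i* y)%C =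
  ((ln (1 + s) / 2 - x) +i* (atan (y / (1 + x)) - y))%C.
  by rewrite /Log el ea /= add0r.
apply: le_trans (cmod_le _ _) _.
(* The difference is (ln(1+s) - s)/2 + r^2/2, at most 9 r^2 + r^2/2 in modulus. *)
have hA : `|ln (1 + s) / 2 - x| <= 10 * r ^+ 2.
  have := @ln1D_approx s; rewrite (le_trans sr) => [/(_ isT)|]; last lra.
  have : s ^+ 2 <= 9 * r ^+ 2.
    rewrite -[s ^+ 2]real_normK ?num_real //; have := normr_ge0 s; nra.
  rewrite !ler_norml => s2 /andP[l1 l2].
  have : s = 2 * x + r ^+ 2 by [].
  have := sqr_ge0 r.
  lra.
have hB : `|atan (y / (1 + x)) - y| <= 2 * r ^+ 2.
  set q := y / _; have hq : `|q| <= 6 / 5 * r.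
    rewrite normrM normfV (ger0_norm (ltW x0)) ler_pdivrMr //; nra.
  have eq : q - y = - (x * q) by rewrite /q; field; lra.
  have -> : atan q - y = (atan q - q) + (q - y) by ring.
  apply: le_trans (ler_normD _ _) _; rewrite eq normrN normrM.
  (* Used with X = |x|, Q = |q|, A = |atan q - q|; since r <= 1/6 gives Q <= 1/5, the cubic term is
     bounded by a multiple of r^2. *)
  have key (X Q A : R) : 0 <= X -> 0 <= Q -> X <= r -> Q <= 6 / 5 * r ->
      A <= Q ^+ 3 -> A + X * Q <= 2 * r ^+ 2.
    move=> X0 Q0 Xr Qr AQ.
    have Q2 : Q * Q <= (6 / 5 * r) * (6 / 5 * r) by apply: ler_pM.
    have Q3 : Q * (Q * Q) <= 1 / 5 * ((6 / 5 * r) * (6 / 5 * r)).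
      by apply: ler_pM; rewrite ?mulr_ge0 //; lra.
    have XQ : X * Q <= r * (6 / 5 * r) by apply: ler_pM.
    by move: AQ; rewrite !exprS !expr0 !mulr1; nra.
  by apply: key => //; exact: atan_approx.
have := sqr_ge0 r; lra.
Qed.

Lemma Re1D_gt0 u : `|u| < 1 -> 0 < complex.Re (1 + u).
Proof.
move=> u1; have : (`|complex.Re u|%:C < 1%:C)%C.
  exact: le_lt_trans (normc_ge_Re u) u1.
rewrite ltcR ltr_norml => /andP[u2 _].
have -> : complex.Re (1 + u) = 1 + complex.Re u by case: (u).
by rewrite -ltrBlDl sub0r.
Qed.

(** Writing u + h = u (1 + h/u) and splitting the logarithm reduces the difference quotient to the
    quadratic estimate at h/u. *)
Lemma is_derive_Log1D (t : cplx R) : 0 < complex.Re (1 + t) ->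
  is_derive t 1 (fun s : cplx R => Log (1 + s)) (1 + t)^-1.
Proof.
move=> Ret; set u := 1 + t.
have u0 : u != 0 by apply: contraTneq Ret; rewrite /u => ->; rewrite ltxx.
suff lim : (fun h : cplx R => h^-1 *:
    (((fun s : cplx R => Log (1 + s)) \o shift t) (h *: 1) - Log (1 + t))) h
    @[h --> 0^'] --> u^-1.
  apply: DeriveDef; first by apply/cvg_ex; exists u^-1.
  exact: cvg_lim lim.
apply/cvgrPdist_le => e e0; near=> h.
have h0 : h != 0 by near: h; exact: nbhs_dnbhs_neq.
have hu : `|h / u| <= (6^-1)%:C%C.
  rewrite normrM normfV ler_pdivrMr ?normr_gt0 //; apply: ltW.
  near: h; apply: dnbhs0_lt; rewrite mulr_gt0 ?normr_gt0 // ltcR; lra.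
(* This threshold makes the final error 14 |h| / |u|^2 at most e. *)
have he : `|h| <= e * `|u| ^+ 2 / 14.
  apply: ltW; near: h; apply: dnbhs0_lt.
  by rewrite !mulr_gt0 ?exprn_gt0 ?normr_gt0 // invr_gt0.
have -> : ((fun s : cplx R => Log (1 + s)) \o shift t) (h *: 1) = Log (u * (1 + h / u)).
  rewrite /= /GRing.scale /= mulr1; congr Log; rewrite mulrDr mulr1 mulrCA divff // mulr1.
  by rewrite /u; ring.
rewrite LogM //; last first.
  apply: Re1D_gt0; apply: le_lt_trans hu _.
  by rewrite (_ : 1 = 1%:C%C) // ltcR; lra.
rewrite [_ *: _](_ : _ = u^-1 + h^-1 * (Log (1 + h / u) - h / u)); last first.
  by rewrite /GRing.scale /= -/u; field; rewrite u0.
rewrite opprD addrA subrr sub0r normrN normrM normfV.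
rewrite ler_pdivrMl ?normr_gt0 //; apply: le_trans (Log1D_approx hu) _.
rewrite normrM normfV.
have up : 0 < `|u| by rewrite normr_gt0.
have -> : 14 * (`|h| / `|u|) ^+ 2 = `|h| * (14 * `|h| / `|u| ^+ 2).
  by field; rewrite gt_eqF.
apply: ler_wpM2l => //; rewrite ler_pdivrMr ?exprn_gt0 //.
by rewrite mulrC -ler_pdivlMr.
Unshelve. all: by end_near. Qed.

End PrincipalLog.

(** * Symmetry and coefficients of the Jacobi sum *)

Section MainComputation.
Variable K : numFieldType.
Implicit Types z w : K.

(* The polynomial in x whose x^k-coefficient is n! (z - w)^k G_k. *)
Definition jacobi_sum n z w : {poly K} :=
  \sum_(j < n.+1) falling ((n%:R)%:P + 'X) (n - j) * falling (- (n.+1%:R)%:P) j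
     * z%:P ^+ j * (z%:P - w%:P) ^+ (n - j) *+ 'C(n, j).

Lemma rmorph_falling (A B : comNzRingType) (f : {rmorphism A -> B}) x m :
  f (falling x m) = falling (f x) m.
Proof. by rewrite rmorph_prod; apply: eq_bigr => i _; rewrite rmorphB rmorph_nat. Qed.

(** In the Jacobi form, i -> n - i exchanges z with w and the two falling factorials, the latter
    being the effect of x -> -x. *)
Lemma jacobi_sum_sym n z w : jacobi_sum n z w = jacobi_sum n w z \Po (- 'X).
Proof.
rewrite /jacobi_sum !polyC_natr !jacobi_symm rmorphM rmorph_sum /= rmorphXn rmorphN1.
congr (_ * _); rewrite (reindex_inj rev_ord_inj); apply: eq_bigr => i _ /=.
have lein : (i <= n)%N by rewrite -ltnS.
rewrite subSS subKn // bin_sub // rmorphMn !rmorphM !rmorphXn /= !rmorph_falling /=.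
rewrite rmorphD rmorphB rmorph_nat /= comp_polyX opprK !comp_polyC; congr (_ *+ _).
ring.
Qed.

Lemma coef_comp_polyNX (p : {poly K}) k : (p \Po (- 'X))`_k = (-1) ^+ k * p`_k.
Proof.
rewrite -{2}[p]comp_polyXr !coef_comp_poly mulr_sumr; apply: eq_bigr => i _.
have -> : (- 'X) ^+ i = ((-1) ^+ i)%:P * 'X^i :> {poly K}.
  by rewrite [(- 'X) ^+ i]exprNn rmorphXn rmorphN1.
rewrite coefCM coefXn mulrCA.
by case: eqP => [->|_]; rewrite // !mulr0.
Qed.

Lemma coef_jacobi_sum n k z w : (jacobi_sum n z w)`_k =
  \sum_(j < n.+1) (falling ((n%:R)%:P + 'X) (n - j))`_k * falling (- n.+1%:R) j
     * z ^+ j * (z - w) ^+ (n - j) *+ 'C(n, j).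
Proof.
rewrite coef_sum; apply: eq_bigr => j _; rewrite coefMn; congr (_ *+ _).
by rewrite -polyCN -rmorph_falling -polyCB -!rmorphXn /= !coefMC.
Qed.

(** A product of monic linear factors has known size and leading coefficient. *)
Lemma falling_prod_XsubC (c : K) m :
  falling (c%:P + 'X) m = \prod_(i <- enum 'I_m) ('X - (i%:R - c)%:P).
Proof.
rewrite big_enum; apply: eq_bigr => i _; rewrite polyCB polyC_natr; ring.
Qed.

Lemma coef_falling_small (c : K) m k : (m < k)%N -> (falling (c%:P + 'X) m)`_k = 0.
Proof.
move=> mk; apply: nth_default.
by rewrite falling_prod_XsubC size_prod_XsubC size_enum_ord.
Qed.

Lemma coef_falling_lead (c : K) m : (falling (c%:P + 'X) m)`_m = 1.
Proof.
have /monicP := monic_prod_XsubC (enum 'I_m) xpredT (fun i : 'I_m => i%:R - c).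
by rewrite -falling_prod_XsubC lead_coefE falling_prod_XsubC size_prod_XsubC size_enum_ord.
Qed.

Lemma falling_oppS_neq0 n j : falling (- n.+1%:R : K) j != 0.
Proof.
apply/prodf_neq0 => i _.
by rewrite -opprD oppr_eq0 -natrD pnatr_eq0.
Qed.

(** The coefficient of z^j (z-w)^(n-k-j) in G_k, for lambda = n + 1. *)
Definition G_coef n k j : K :=
  (falling ((n%:R)%:P + 'X) (n - j))`_k * falling (- n.+1%:R) j *+ 'C(n, j) / n`!%:R.

(** (n+x)_(n-j) has degree n - j in x, so terms with j > n - k do not reach x^k; in the others
    (z-w)^(n-j) is divisible by (z-w)^k. *)
Lemma coef_jacobi_sum_factor n k z w : (k <= n)%N -> (jacobi_sum n z w)`_k / n`!%:R =
  (z - w) ^+ k * \sum_(j < (n - k).+1) G_coef n k j * (z ^+ j * (z - w) ^+ (n - k - j)).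
Proof.
move=> kn; rewrite coef_jacobi_sum.
rewrite -(big_mkord xpredT (fun j => (falling ((n%:R)%:P + 'X) (n - j))`_k *
  falling (- n.+1%:R) j * z ^+ j * (z - w) ^+ (n - j) *+ 'C(n, j))).
rewrite (@big_cat_nat _ _ _ (n - k).+1) //=; last by rewrite ltnS leq_subr.
rewrite [X in _ + X]big_nat [X in _ + X]big1 ?addr0; last first.
  by move=> j jn; rewrite coef_falling_small ?mul0r ?mul0rn //; lia.
rewrite big_mkord mulr_suml mulr_sumr; apply: eq_bigr => j _.
have -> : (z - w) ^+ (n - j) = (z - w) ^+ (n - k - j) * (z - w) ^+ k.
  by rewrite -exprD; congr (_ ^+ _); have := ltn_ord j; lia.
rewrite /G_coef !(mulrnAl, mulrnAr); congr (_ *+ _).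
ring.
Qed.

End MainComputation.

(** * Reduction of [G] to the Jacobi sum, and the conclusion *)

(** The factor (z-w)^k completes the prefactor to (z-w)^(2n+1), which clears the denominators
    (z-w)^(n+1+j) of the derivative at 0 and leaves (z-w)^(n-j). *)
Lemma G_jacobi_sum (R : realType) n k (z w : cplx R) : z != w -> (k <= n)%N ->
  (z - w) ^+ k * G n.+1 k z w = (jacobi_sum n z w)`_k / n`!%:R.
Proof.
move=> zw kn; have d0 : z - w != 0 by rewrite subr_eq0.
have e0 : 0 < `|z - w| + `|z| by rewrite ltr_pwDl // normr_gt0.
(* On |t| < e both Re (1 + t) > 0 and (1 + t) z != w. *)
pose e := `|z - w| / (`|z - w| + `|z|).
have De (t : cplx R) : ball (0 : cplx R) e t -> 0 < complex.Re (1 + t) /\ (1 + t) * z - w != 0.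
  rewrite -ball_normE /= sub0r normrN => te; split.
    apply: Re1D_gt0; apply: lt_le_trans te _.
    by rewrite ler_pdivrMr // mul1r lerDl.
  have -> : (1 + t) * z - w = (z - w) + t * z by ring.
  (* The summand |z-w| in the denominator of [e] makes e |z| < |z-w|, also for z = 0. *)
  have tz : `|t * z| < `|z - w|.
    rewrite normrM; apply: (@le_lt_trans _ _ (e * `|z|)).
      by rewrite ler_wpM2r // ltW.
    rewrite /e mulrAC ltr_pdivrMr // ltr_pM2l ?normr_gt0 //.
    by rewrite ltr_pwDl ?normr_gt0.
  apply: contraTneq tz => /eqP; rewrite addr_eq0 => /eqP ->.
  by rewrite normrN ltxx.
have U0 (t : cplx R) : 0 < complex.Re (1 + t) -> 1 + t != 0.
  by move=> t0; apply: contraTneq t0 => ->; rewrite ltxx.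
have dU (t : cplx R) : is_derive t 1 (fun s : cplx R => 1 + s) 1.
  by rewrite -[X in is_derive _ _ _ X]add0r; exact: is_deriveD.
have dh (t : cplx R) : is_derive t 1 (fun s : cplx R => (1 + s) * z - w) z.
  have -> : (fun s : cplx R => (1 + s) * z - w) = (fun s => 1 + s) * cst z - cst w.
    by apply/funext.
  apply: is_derive_eq.
  by rewrite /= scaler0 add0r subr0 /GRing.scale /= mulr1.
have D0 : ball (0 : cplx R) e 0 by apply: ballxx; rewrite divr_gt0 // normr_gt0.
(* The quadratic estimate at u = 0 gives |Log 1| <= 0. *)
have L0 : Log (1 + 0) = 0 :> cplx R.
  have h := @Log1D_approx R 0; apply/eqP; rewrite -normr_le0.
  apply: le_trans (_ : 14 * `|0 : cplx R| ^+ 2 <= 0); last first.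
    by rewrite normr0 expr0n mulr0.
  by rewrite -[X in `|X|]subr0 h // normr0 ler0c; lra.
have DU (t : cplx R) : ball (0 : cplx R) e t -> 1 + t != 0 by move=> /De [/U0].
have Dh (t : cplx R) : ball (0 : cplx R) e t -> (1 + t) * z - w != 0 by move=> /De [].
have dL (t : cplx R) : ball (0 : cplx R) e t ->
    is_derive t 1 (fun s : cplx R => Log (1 + s)) (1 + t)^-1.
  by move=> /De [t0 _]; exact: is_derive_Log1D.
have hd : (1 + 0) * z - w = z - w by rewrite addr0 mul1r.
have deriv := derive1n_log_power (ball_open _ _) DU Dh (fun t _ => dU t) dL
  (fun t _ => dh t) n k n.+1 n D0 L0 (addr0 1).
rewrite /G subSS subn0 deriv hd coef_jacobi_sum mul1r.
set S := \sum_(j < _) _; set S' := \sum_(j < _) _.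
have -> : S' = (z - w) ^+ (2 * n).+1 * S.
  rewrite mulr_sumr; apply: eq_bigr => j _; rewrite mulrnAr; congr (_ *+ _).
  have -> : (z - w) ^+ (2 * n).+1 = (z - w) ^+ (n.+1 + j) * (z - w) ^+ (n - j).
    by rewrite -exprD; congr (_ ^+ _); have := ltn_ord j; lia.
  by field; rewrite expf_neq0.
have -> : (z - w) ^+ (2 * n).+1 = (z - w) ^+ k * (z - w) ^+ (2 * n.+1 - 1 - k).
  by rewrite -exprD; congr (_ ^+ _); lia.
by field; rewrite !pnatr_eq0 -!lt0n !fact_gt0.
Qed.

Theorem proposition8 (R : realType) (lambda k : nat)
    (hlambda : (1 <= lambda)%N) (hk : (k <= lambda - 1)%N) :
  (exists P : mpoly 2 (cplx R),
     [/\ P \is ishomog1 (lambda - 1 - k) mdeg,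
         P != 0
       & forall z w : cplx R, z != w ->
           G lambda k z w = meval (tnth [tuple z; w]) P]) /\
  (forall z w : cplx R, z != w -> G lambda k z w = G lambda k w z).
Proof.
case: lambda hlambda hk => // n _; rewrite subn1 /= => kn; split; last first.
  move=> z w zw; have d0 : (z - w) ^+ k != 0 by rewrite expf_neq0 // subr_eq0.
  (* Both sides times (z-w)^k agree, since (-1)^k (w-z)^k = (z-w)^k. *)
  apply: (mulfI d0); rewrite G_jacobi_sum // jacobi_sum_sym coef_comp_polyNX -mulrA.
  by rewrite -G_jacobi_sum // 1?eq_sym // mulrA -exprMn mulN1r opprB.
pose X (i : 'I_2) : mpoly 2 (cplx R) := mpolyX _ (mnm1 i).
exists (\sum_(j < (n - k).+1)
  G_coef (cplx R) n k j *: (X 0 ^+ j * (X 0 - X 1) ^+ (n - k - j))).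
have evalP z w : meval (tnth [tuple z; w]) (\sum_(j < (n - k).+1)
    G_coef (cplx R) n k j *: (X 0 ^+ j * (X 0 - X 1) ^+ (n - k - j))) =
  \sum_(j < (n - k).+1) G_coef (cplx R) n k j * (z ^+ j * (z - w) ^+ (n - k - j)).
  rewrite rmorph_sum; apply: eq_bigr => j _.
  by rewrite /= mevalZ rmorphM !rmorphXn rmorphB /= !mevalXU.
split.
- apply: rpred_sum => j _; apply: rpredZ.
  have Xhom i : X i \is ishomog1 1 mdeg by rewrite dhomogX; apply/eqP; exact: mdeg1.
  have := dhomogM (dhomogMn j (Xhom 0)) (dhomogMn (n - k - j) (rpredB (Xhom 0) (Xhom 1))).
  by rewrite !mul1n subnKC // -ltnS.
(* [evalP] holds on the diagonal too, where [G] itself is not controlled. At (1,1) only j = n - k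
   survives, through 0^0 = 1, and its coefficient is nonzero. *)
- apply/eqP => P0; have /esym/eqP := evalP 1 1.
  rewrite P0 meval0 subrr big_ord_recr big1 /= => [|j _]; last first.
    by rewrite (expr0n _ (n - k - j)) subn_eq0 leqNgt ltn_ord !mulr0.
  rewrite add0r subnn !expr0 expr1n !mulr1 /G_coef subKn // coef_falling_lead mul1r.
  apply/negP; rewrite mulf_neq0 // ?invr_eq0 ?pnatr_eq0 -?lt0n ?fact_gt0 //.
  by rewrite -mulr_natr mulf_neq0 ?falling_oppS_neq0 // pnatr_eq0 -lt0n bin_gt0 leq_subr.
- move=> z w zw; have d0 : (z - w) ^+ k != 0 by rewrite expf_neq0 // subr_eq0.
  by apply: (mulfI d0); rewrite G_jacobi_sum // coef_jacobi_sum_factor // evalP.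
Qed.
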